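(* In the setting described in the context, suppose Assumptions 1--5 there hold, and let $v(0)\in\mathbb V$, $w\in\mathbb W$, $\sigma\in\mathbb S$. Let $\theta(t)=\boldsymbol\eta^\star(t)=Q\boldsymbol\xi(t)\in\mathbb R^{2n}$. Then for all $t\ge0$ the real Hankel matrix $\Theta(\boldsymbol\eta^\star(t))$ is nonsingular, and the linear time-varying equation $$\Theta(\boldsymbol\eta^\star(t))\,\check a+\mathrm{col}\big(\boldsymbol\eta^\star_{n+1}(t),\dots,\boldsymbol\eta^\star_{2n}(t)\big)=0$$ in the unknown $\check a\in\mathbb R^n$ has a unique solution $\check a=\check a(\theta(t))$, which satisfies $\check a(\theta(t))=a(\sigma)$ for all $t\ge0$.
   Context: Notation: $\mathrm{col}(\cdot)$ stacks vectors. Plant: $\dot z=f(z,y,v,w)$, $\dot x=A_cx+g(z,y,v,w)+B_cbu$, $y=C_cx$, $e=y-h(v,w)$, with $z\in\mathbb R^{n_z}$, $x\in\mathbb R^r$ ($r\ge2$), $u,y,e\in\mathbb R$, $b>0$ constant, $w\in\mathbb W\subset\mathbb R^{n_w}$; $A_c$ has ones on the superdiagonal and zeros elsewhere, $B_c=(0,\dots,0,1)^\top$, $C_c=(1,0,\dots,0)$. The functions $f,g,h$ are sufficiently smooth with $h(0,w)=0$, $f(0,0,0,w)=0$, $g(0,0,0,w)=0$ for all $w\in\mathbb W$. Exosystem: $\dot v=S(\sigma)v$, $v\in\mathbb R^{n_v}$, $\sigma\in\mathbb S\subset\mathbb R^{n_\sigma}$. The sets $\mathbb S\subset\mathbb R^{n_\sigma}$,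 $\mathbb W\subset\mathbb R^{n_w}$, $\mathbb V\subset\mathbb R^{n_v}$ are compact, and $\mathbb W$ and $\mathbb V$ contain the origin. Put $\mu=\mathrm{col}(v,w,\sigma)$. Filter: $\dot{\hat x}=A\hat x+B_cu$, $\hat x\in\mathbb R^r$, with $A=A_c-\lambda C_c$ Hurwitz, $\lambda\in\mathbb R^r$. Assumption 1: for all $\sigma\in\mathbb S$ the eigenvalues of $S(\sigma)$ are distinct and lie on the imaginary axis. Assumption 2: there are globally defined smooth functions $\mathbf x(\mu),\mathbf z(\mu),\mathbf u(\mu)$ with $\mathbf z(0,w,\sigma)=0$, $\mathbf x_1(\mu)=h(v,w)$ and $\frac{\partial\mathbf z}{\partial v}S(\sigma)v=f(\mathbf z,h(v,w),v,w)$, $\frac{\partial\mathbf x}{\partial v}S(\sigma)v=A_c\mathbf x+g(\mathbf z,\mathbf x_1,v,w)+B_cb\,\mathbf u$. Assumption 3: the system $\dot{\bar z}=f(\bar z+\mathbf z(\mu),e+h(v,w),v,w)-f(\mathbf z(\mu),h(v,w),v,w)$ is input-to-state stable with state $\bar z$ and input $e$. Assumption 4: $\mathbf u(v,w,\sigma)$ is a polynomial in $v$ with coefficients depending on $w,\sigma$. Steady state of the filter: under these assumptions $\mathbf u=\Gamma_u\tau_u(v)$ with $\tau_u$ a vector of monomials in $v$ obeying $\dot\tau_u=\Phi_u(\sigma)\tau_u$, and $\hat{\mathbf x}(\mu)=P_u\tau_u(v)$, with $P_u$ the unique solution of $P_u\Phi_u=AP_u+B_c\Gamma_u$, satisfies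 $\dot{\hat{\mathbf x}}=A\hat{\mathbf x}+B_c\mathbf u$. Its second component is written $\hat{\mathbf x}_2(v(t),w,\sigma)=\sum_{j=1}^nC_j(v(0),w,\sigma)e^{\imath\hat\omega_jt}$ with distinct real frequencies $\hat\omega_1,\dots,\hat\omega_n$. Assumption 5: $C_j(v(0),w,\sigma)\ne0$ for all $1\le j\le n$ and any $v(0)\in\mathbb V$, $w\in\mathbb W$, $\sigma\in\mathbb S$. Steady-state generator and internal model: $a(\sigma)=\mathrm{col}(a_1,\dots,a_n)\in\mathbb R^n$ is the coefficient vector with $s^n+\sum_{j=1}^na_js^{j-1}=\prod_{j=1}^n(s-\imath\hat\omega_j)$, so that $\hat{\mathbf x}_2^{(n)}+a_n\hat{\mathbf x}_2^{(n-1)}+\dots+a_1\hat{\mathbf x}_2=0$. $\Phi(a)\in\mathbb R^{n\times n}$ is the companion matrix with ones on the superdiagonal, last row $(-a_1,\dots,-a_n)$ and zeros elsewhere; $\Gamma=(1,0,\dots,0)\in\mathbb R^{1\times n}$; $\boldsymbol\xi=\mathrm{col}(\hat{\mathbf x}_2,\dot{\hat{\mathbf x}}_2,\dots,\hat{\mathbf x}_2^{(n-1)})$, so $\dot{\boldsymbol\xi}=\Phi(a(\sigma))\boldsymbol\xi$, $\hat{\mathbf x}_2=\Gamma\boldsymbol\xi$. $M\in\mathbb R^{2n\times2n}$ is a Hurwitz companion matrix with ones on the superdiagonal, last row $(-m_1,\dots,-m_{2n})$ and zeros elsewhere, and $N=(0,\dots,0,1)^\top\in\mathbb R^{2n}$.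 $Q\in\mathbb R^{2n\times n}$ is the unique solution of the Sylvester equation $MQ-Q\Phi(a(\sigma))=-N\Gamma$; its $j$-th row is $Q_j=\Gamma\,\Xi(a)^{-1}\Phi(a)^{j-1}$, where $\Xi(a)=\Phi(a)^{2n}+\sum_{j=1}^{2n}m_j\Phi(a)^{j-1}$ is nonsingular at $a=a(\sigma)$. For $\eta\in\mathbb R^{2n}$, $\Theta(\eta)\in\mathbb R^{n\times n}$ is the Hankel matrix with $(i,j)$ entry $\eta_{i+j-1}$. *)

(* Defs.v *)
From HB Require Import structures.
From mathcomp Require Import all_boot all_order all_algebra.
From mathcomp Require Import all_classical all_reals all_analysis.
From mathcomp Require Import ess_sup_inf complex.

Set Implicit Arguments.
Unset Strict Implicit.
Unset Printing Implicit Defensive.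

Import Order.TTheory GRing.Theory Num.Theory.
Import numFieldNormedType.Exports.

Local Open Scope classical_set_scope.
Local Open Scope ring_scope.

(* Indices are 0-based throughout: the k-th component of a vector is its      *)
(* entry of index k - 1.                                                      *)

Section Structured_matrices.
Variable R : realType.
Implicit Type k : nat.

Definition shift_mx k : 'M[R]_k := \matrix_(i, j) (i.+1 == j :> nat)%:R.

Definition first_row k : 'rV[R]_k := \row_j (j == 0%N :> nat)%:R.

Definition last_col k : 'cV[R]_k := \col_i (i.+1 == k :> nat)%:R.

(* The rank-one term overwrites the (null) last row of [shift_mx] by -c^T.    *)
Definition companion k (c : 'cV[R]_k) : 'M[R]_k :=
  shift_mx k - last_col k *m c^T.

Definition complexify m k (A : 'M[R]_(m, k)) : 'M[R[i]]_(m, k) :=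
  map_mx (real_complex R) A.

Definition hurwitz k (A : 'M[R]_k) : Prop :=
  forall x : R[i], eigenvalue (complexify A) x -> complex.Re x < 0.

Lemma hankel_subproof n (i j : 'I_n) : (i + j < n + n)%N.
Proof.
by rewrite (leq_trans _ (leq_add (ltn_ord i) (ltn_ord j))) // addSn addnS.
Qed.

Definition hankel n (eta : 'cV[R]_(n + n)) : 'M[R]_n :=
  \matrix_(i, j) eta (Ordinal (hankel_subproof i j)) 0.

Definition expi (x : R) : R[i] := (cos x +i* sin x)%C.

End Structured_matrices.

Section Smoothness.
Variable R : realType.

(* C^k maps through iterated directional derivatives; the spaces used are     *)
(* finite products of spaces of column vectors, where this is the usual       *)
(* notion.                                                                    *)
Fixpoint Ck (k : nat) (U V : normedModType R) (F : U -> V) : Prop :=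
  match k with
  | 0 => continuous F
  | k'.+1 => [/\ continuous F, (forall x d, derivable F x d) &
               forall d, Ck k' (fun x => 'D_d F x)]
  end.

Definition smooth (U V : normedModType R) (F : U -> V) : Prop :=
  forall k, Ck k F.

End Smoothness.

Section Input_to_state_stability.
Variable R : realType.
Let mu := @lebesgue_measure R.

Definition classK (g : R -> R) : Prop :=
  [/\ {within `[0, +oo[, continuous g},
      (forall x y, 0 <= x -> x < y -> g x < g y) & g 0 = 0].

Definition classKL (beta : R -> R -> R) : Prop :=
  (forall t, 0 <= t -> classK (beta ^~ t)) /\
  (forall s, 0 <= s ->
     (forall t1 t2, 0 <= t1 -> t1 <= t2 -> beta s t2 <= beta s t1) /\
     beta s t @[t --> +oo] --> 0).

Definition ess_norm (e : R -> R) (t0 t : R) : \bar R :=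
  ess_sup mu (fun s => (`|e s| * \1_(`[t0, t] : set R) s)%:E).

Definition iss_input (e : R -> R) : Prop :=
  measurable_fun setT e /\
  forall t0 t, (ess_norm e t0 t < +oo)%E.

(* Caratheodory solution on [t0, +oo[, in integral form.                      *)
Definition solution k (F : R -> 'cV[R]_k -> R -> 'cV[R]_k) (e : R -> R)
    (t0 : R) (x : R -> 'cV[R]_k) : Prop :=
  forall t, t0 <= t -> forall i,
    mu.-integrable `[t0, t] (fun s => (F s (x s) (e s) i 0)%:E) /\
    x t i 0 = x t0 i 0 + \int[mu]_(s in `[t0, t]) (F s (x s) (e s) i 0).

(* Input-to-state stability of the time-varying system x' = F(t, x, e),       *)
(* uniformly in the initial time.                                             *)
Definition iss k (F : R -> 'cV[R]_k -> R -> 'cV[R]_k) : Prop :=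
  exists (beta : R -> R -> R) (gamma : R -> R),
    [/\ classKL beta, classK gamma &
      forall (t0 : R) (x0 : 'cV[R]_k) (e : R -> R), 0 <= t0 -> iss_input e ->
        (exists2 x, x t0 = x0 & solution F e t0 x) /\
        (forall x, x t0 = x0 -> solution F e t0 x ->
           forall t, t0 <= t ->
             `|x t| <= beta `|x0| (t - t0) + gamma (fine (ess_norm e t0 t)))].

End Input_to_state_stability.

Section Regulation.
Variables (R : realType) (nz nv nw ns r : nat).

Local Notation vec k := 'cV[R]_k (only parsing).

Definition exo_traj (S : vec ns -> 'M[R]_nv) (sigma : vec ns)
    (v : R -> vec nv) : Prop :=
  forall t : R, is_derive t 1 v (S sigma *m v t).

(* The eigenvalues are counted with multiplicity: [s] lists all the roots of  *)
(* the characteristic polynomial.                                             *)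
Definition assumption1 (Sset : set (vec ns)) (S : vec ns -> 'M[R]_nv) : Prop :=
  forall sigma, Sset sigma ->
    exists s : seq R[i],
      [/\ char_poly (complexify (S sigma)) = \prod_(x <- s) ('X - x%:P),
          uniq s & forall x, x \in s -> complex.Re x = 0].

(* The regulator equations; (partial z / partial v) S(sigma) v is the         *)
(* derivative of z(., w, sigma) at v in the direction S(sigma) v.             *)
Definition assumption2 (hr : (1 < r)%N)
    (W : set (vec nw)) (Sset : set (vec ns)) (S : vec ns -> 'M[R]_nv)
    (f : vec nz * R * vec nv * vec nw -> vec nz)
    (g : vec nz * R * vec nv * vec nw -> vec r)
    (h : vec nv * vec nw -> R) (b : R)
    (x : vec nv * vec nw * vec ns -> vec r)
    (z : vec nv * vec nw * vec ns -> vec nz)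
    (u : vec nv * vec nw * vec ns -> R) : Prop :=
  [/\ smooth x, smooth z, smooth u,
      (forall w sigma, W w -> Sset sigma -> z (0, w, sigma) = 0) &
      forall v w sigma, W w -> Sset sigma ->
      let mu := (v, w, sigma) in
      let x1 := x mu (Ordinal (ltnW hr)) 0 in
      [/\ x1 = h (v, w),
          'D_(S sigma *m v) (fun v' => z (v', w, sigma)) v =
            f (z mu, h (v, w), v, w) &
          'D_(S sigma *m v) (fun v' => x (v', w, sigma)) v =
            shift_mx R r *m x mu + g (z mu, x1, v, w)
              + (b * u mu) *: last_col R r]].

Definition assumption3 (V : set (vec nv)) (W : set (vec nw))
    (Sset : set (vec ns)) (S : vec ns -> 'M[R]_nv)
    (f : vec nz * R * vec nv * vec nw -> vec nz)
    (h : vec nv * vec nw -> R)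
    (z : vec nv * vec nw * vec ns -> vec nz) : Prop :=
  forall v w sigma, exo_traj S sigma v -> V (v 0) -> W w -> Sset sigma ->
    iss (fun t zbar e =>
      let zs := z (v t, w, sigma) in
      f (zbar + zs, e + h (v t, w), v t, w) - f (zs, h (v t, w), v t, w)).

(* [alpha k] is the multi-exponent of the k-th monomial.                      *)
Definition monomials d (alpha : 'I_d -> 'I_nv -> nat) (v : vec nv) : vec d :=
  \col_k \prod_(i < nv) v i 0 ^+ alpha k i.

Definition assumption4 (W : set (vec nw)) (Sset : set (vec ns))
    (u : vec nv * vec nw * vec ns -> R) : Prop :=
  exists (d : nat) (alpha : 'I_d -> 'I_nv -> nat)
         (c : vec nw -> vec ns -> 'rV[R]_d),
  forall v w sigma, W w -> Sset sigma ->
    u (v, w, sigma) = (c w sigma *m monomials alpha v) 0 0.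

(* tau' = Phi_u(sigma) tau along v' = S(sigma) v, and u = Gamma_u tau.        *)
Definition input_generator d (W : set (vec nw)) (Sset : set (vec ns))
    (S : vec ns -> 'M[R]_nv) (u : vec nv * vec nw * vec ns -> R)
    (alpha : 'I_d -> 'I_nv -> nat)
    (Phiu : vec ns -> 'M[R]_d) (Gammau : vec nw -> vec ns -> 'rV[R]_d) : Prop :=
  forall v w sigma, W w -> Sset sigma ->
    'D_(S sigma *m v) (monomials alpha) v = Phiu sigma *m monomials alpha v /\
    u (v, w, sigma) = (Gammau w sigma *m monomials alpha v) 0 0.

Definition filter_mx (lambda : vec r) : 'M[R]_r :=
  shift_mx R r - lambda *m first_row R r.

Definition xhat d (alpha : 'I_d -> 'I_nv -> nat)
    (Pu : vec nw -> vec ns -> 'M[R]_(r, d))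
    (mu : vec nv * vec nw * vec ns) : vec r :=
  let: (v, w, sigma) := mu in Pu w sigma *m monomials alpha v.

Definition xhat2 (hr : (1 < r)%N) d (alpha : 'I_d -> 'I_nv -> nat)
    (Pu : vec nw -> vec ns -> 'M[R]_(r, d))
    (mu : vec nv * vec nw * vec ns) : R :=
  xhat alpha Pu mu (Ordinal hr) 0.

(* [q] is x2hat, as a function of (v, w, sigma).                              *)
Definition harmonic_expansion n (V : set (vec nv)) (W : set (vec nw))
    (Sset : set (vec ns)) (S : vec ns -> 'M[R]_nv)
    (q : vec nv * vec nw * vec ns -> R)
    (omega : vec ns -> 'I_n -> R)
    (C : 'I_n -> vec nv * vec nw * vec ns -> R[i]) : Prop :=
  (forall sigma, Sset sigma -> injective (omega sigma)) /\
  (forall v w sigma, exo_traj S sigma v -> V (v 0) -> W w -> Sset sigma ->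
     forall t : R, (q (v t, w, sigma))%:C%C =
       \sum_(j < n) C j (v 0, w, sigma) * expi (omega sigma j * t)).

Definition assumption5 n (V : set (vec nv)) (W : set (vec nw))
    (Sset : set (vec ns)) (C : 'I_n -> vec nv * vec nw * vec ns -> R[i]) :
    Prop :=
  forall j v0 w sigma, V v0 -> W w -> Sset sigma -> C j (v0, w, sigma) != 0.

Definition generator_coefs n (Sset : set (vec ns))
    (omega : vec ns -> 'I_n -> R) (a : vec ns -> vec n) : Prop :=
  forall sigma, Sset sigma ->
    'X^n + \sum_(j < n) (a sigma j 0)%:C%C *: 'X^j =
    \prod_(j < n) ('X - (0 +i* omega sigma j)%C%:P) :> {poly R[i]}.

Definition derivatives_col n (p : R -> R) (t : R) : vec n :=
  \col_(k < n) derive1n k p t.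

End Regulation.

(* Main.v *)
Require Import Defs.
From HB Require Import structures.
From mathcomp Require Import all_boot all_order all_algebra.
From mathcomp Require Import all_classical all_reals all_analysis.
From mathcomp Require Import complex ring.

Import Order.TTheory GRing.Theory Num.Theory.
Import numFieldNormedType.Exports.

Local Open Scope classical_set_scope.
Local Open Scope ring_scope.

(* Writing mu_j = i omega_j and p_k(x) = col(1, x, ..., x^(k-1)), the         *)
(* expansion of x2hat gives xi(t) = \sum_j c_j(t) p_n(mu_j), c_j(t) <> 0.     *)
(* The p_n(mu_j) are eigenvectors of Phi(a), so each y = Q p_n(mu_j) solves   *)
(* M y - mu_j y = - N; the superdiagonal rows force y = s_j p_2n(mu_j), and   *)
(* the last row forces s_j <> 0. Hence Theta = P diag(c_j s_j) P^T with P the *)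
(* Vandermonde matrix of the distinct mu_j, and a solves the equation because *)
(* theta is a combination of geometric sequences whose ratios mu_j are roots  *)
(* of s^n + \sum_j a_j s^(j-1).                                              *)

(** At each time, theta is a sum of n geometric sequences of length 2n with distinct ratios mu_j and
    nonzero weights c_j s_j. [derive1n_exp_sum] yields the modes of xi, and [sylvester_powers] shows
    that Q only prolongs each mode and rescales it by s_j. [hankel_unitmx] and [hankel_recurrence]
    then hold for any such sum, and give nonsingularity and the solution a(sigma). *)

Section Complex_exponential_sums.
Variable R : realType.
Implicit Types (n : nat) (w : R) (c : R[i]).

Definition imag w : R[i] := (0 +i* w)%C.

Lemma expi_neq0 w : expi w != 0.
Proof.
apply/eqP => -[cw sw]; have := cos2Dsin2 w.
by rewrite cw sw expr0n addr0 => /esym/eqP; rewrite oner_eq0.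
Qed.

Lemma imag_inj : injective imag.
Proof. by move=> x y []. Qed.

Lemma is_derive_linear_comp (f : R -> R) (df w t : R) :
  is_derive (w * t) 1 f df -> is_derive t 1 (fun s => f (w * s)) (df * w).
Proof.
move=> fd; have wd : is_derive t 1 (fun s : R => w * s) w.
  by apply: is_derive_eq; rewrite /GRing.scale/= mulr1 ?mul0r ?addr0.
exact: is_derive1_comp.
Qed.

Lemma is_derive_Re_expi c w (t : R) :
  is_derive t 1 (fun s => complex.Re (c * expi (w * s)))
    (complex.Re (c * imag w * expi (w * t))).
Proof.
case: c => p q /=.
have cd := is_derive_linear_comp cos _ w t (is_derive_cos (w * t)).
have sd := is_derive_linear_comp sin _ w t (is_derive_sin (w * t)).
by apply: is_derive_eq; rewrite /GRing.scale/=; ring.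
Qed.

Lemma is_derive_Im_expi c w (t : R) :
  is_derive t 1 (fun s => complex.Im (c * expi (w * s)))
    (complex.Im (c * imag w * expi (w * t))).
Proof.
case: c => p q /=.
have cd := is_derive_linear_comp cos _ w t (is_derive_cos (w * t)).
have sd := is_derive_linear_comp sin _ w t (is_derive_sin (w * t)).
by apply: is_derive_eq; rewrite /GRing.scale/=; ring.
Qed.

(** Differentiation is over the reals, so real and imaginary parts are treated separately. As p is
    real, the imaginary part of the sum is the zero function, and so is its derivative. *)
Lemma derive1_exp_sum n (omega : 'I_n -> R) (c : 'I_n -> R[i]) (p : R -> R) :
  (forall t, (p t)%:C%C = \sum_(j < n) c j * expi (omega j * t)) ->
  forall t, (derive1 p t)%:C%C =
    \sum_(j < n) c j * imag (omega j) * expi (omega j * t).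
Proof.
move=> pE t.
have pRe : p = \sum_(j < n) fun s => complex.Re (c j * expi (omega j * s)).
  by apply/funext => s; rewrite fct_sumE -raddf_sum -pE.
have pIm : cst 0 =
      \sum_(j < n) fun s => complex.Im (c j * expi (omega j * s)).
  by apply/funext => s; rewrite fct_sumE -raddf_sum -pE.
apply/eqP; rewrite eq_complex /= !raddf_sum derive1E; apply/andP; split.
  rewrite pRe; apply/eqP/(@derive_val _ _ _ t 1).
  by apply: is_derive_sum => j; exact: is_derive_Re_expi.
apply/eqP/esym; rewrite -[RHS](derive_cst (0 : R) t 1) pIm.
apply/esym/(@derive_val _ _ _ t 1).
by apply: is_derive_sum => j; exact: is_derive_Im_expi.
Qed.

Lemma derive1n_exp_sum n (omega : 'I_n -> R) (c : 'I_n -> R[i]) (p : R -> R) :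
  (forall t, (p t)%:C%C = \sum_(j < n) c j * expi (omega j * t)) ->
  forall k t, (derive1n k p t)%:C%C =
    \sum_(j < n) c j * expi (omega j * t) * imag (omega j) ^+ k.
Proof.
move=> pE; elim=> [|k IHk] t.
  by rewrite derive1n0 pE; apply: eq_bigr => j _; rewrite expr0 mulr1.
rewrite derive1nS.
rewrite (@derive1_exp_sum _ omega (fun j => c j * imag (omega j) ^+ k)).
  by apply: eq_bigr => j _; rewrite exprSr; ring.
by move=> s; rewrite IHk; apply: eq_bigr => j _; rewrite mulrAC.
Qed.

End Complex_exponential_sums.

Definition powers {F : pzSemiRingType} k (x : F) : 'cV[F]_k :=
  \col_i x ^+ i.

(** * Eigenvectors and resolvent of companion matrices *)

Section Companion.
Variable R : realType.
Implicit Types (k n : nat) (x : R[i]).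

(** The first sum vanishes on the last row, the second term on all the others. *)
Lemma complexify_companion_mulE k (c : 'cV[R]_k) (y : 'cV[R[i]]_k) i :
  (complexify (companion c) *m y) i 0 =
    \sum_(j < k) (i.+1 == j :> nat)%:R * y j 0 -
    (i.+1 == k :> nat)%:R * \sum_(j < k) (c j 0)%:C%C * y j 0.
Proof.
rewrite mxE mulr_sumr -sumrB; apply: eq_bigr => j _.
rewrite !mxE big_ord1 !mxE rmorphB rmorphM !rmorph_nat.
by rewrite mulrBl mulrA.
Qed.

Lemma sum_next_lt k (y : 'cV[R[i]]_k) (i j : 'I_k) :
  i.+1 = j :> nat -> \sum_(l < k) (i.+1 == l :> nat)%:R * y l 0 = y j 0.
Proof.
move=> ij; rewrite (bigD1 j) //= ij eqxx mul1r big1 ?addr0 // => l lj.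
by rewrite [_ == _]eq_sym (negbTE (lj : (l != j :> nat))) mul0r.
Qed.

Lemma sum_next_last k (y : 'cV[R[i]]_k) (i : 'I_k) :
  i.+1 = k -> \sum_(l < k) (i.+1 == l :> nat)%:R * y l 0 = 0.
Proof.
by move=> ik; apply: big1 => l _; rewrite ik gtn_eqF ?mul0r.
Qed.

(** The superdiagonal rows hold for every x; the last one says that x is a root. *)
Lemma companion_powers n (c : 'cV[R]_n) x :
  x ^+ n + \sum_(j < n) (c j 0)%:C%C * x ^+ j = 0 ->
  complexify (companion c) *m powers n x = x *: powers n x.
Proof.
move=> cx0; apply/matrixP => i j; rewrite ord1 complexify_companion_mulE.
rewrite !mxE -exprS; under [X in _ - _ * X]eq_bigr do rewrite mxE.
have [iltn|] := ltnP i.+1 n.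
  by rewrite (sum_next_lt _ _ _ (Ordinal iltn))// mxE ltn_eqF // mul0r subr0.
rewrite leq_eqVlt ltnNge ltn_ord orbF => /eqP/esym ie.
rewrite sum_next_last // sub0r ie eqxx mul1r.
by apply/esym/eqP; rewrite -addr_eq0 cx0.
Qed.

Lemma companion_resolvent k (m : 'cV[R]_k) x (y : 'cV[R[i]]_k) :
  complexify (companion m) *m y - x *: y = - complexify (last_col R k) ->
  (0 < k)%N -> exists2 s, s != 0 & y = s *: powers k x.
Proof.
case: k m y => // k m y My _.
have Myi i : (complexify (companion m) *m y) i 0 - x * y i 0 =
    - (i.+1 == k.+1 :> nat)%:R.
  by move/matrixP/(_ i 0): My; rewrite !mxE rmorph_nat.
have yE : y = y 0 0 *: powers k.+1 x.
  apply/matrixP => i j; rewrite ord1 !mxE {j}.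
  case: i => i; elim: i => [|i IHi] ilt.
    by rewrite expr0 mulr1; congr (y _ _); apply/val_inj.
  have := Myi (Ordinal (ltnW ilt)); rewrite complexify_companion_mulE.
  rewrite (sum_next_lt _ _ _ (Ordinal ilt)) //= ltn_eqF // mul0r subr0 oppr0.
  by move/eqP; rewrite subr_eq0 => /eqP ->; rewrite IHi exprS mulrCA.
(* If the first entry were 0, then y = 0 and the last row would read 0 = -1. *)
exists (y 0 0) => //; apply/eqP => y00.
have {}yE : y = 0 by rewrite yE y00 scale0r.
have := Myi ord_max; rewrite yE mulmx0 !mxE mulr0 subr0 eqxx => /esym/eqP.
by rewrite oppr_eq0 oner_eq0.
Qed.

Lemma sylvester_powers n (m : 'cV[R]_(n + n)) (c : 'cV[R]_n)
    (Q : 'M[R]_(n + n, n)) x :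
  companion m *m Q - Q *m companion c =
    - (last_col R (n + n) *m first_row R n) ->
  x ^+ n + \sum_(j < n) (c j 0)%:C%C * x ^+ j = 0 -> (0 < n)%N ->
  exists2 s, s != 0 & complexify Q *m powers n x = s *: powers (n + n) x.
Proof.
move=> QE cx0 n_gt0; apply: (@companion_resolvent _ m);
  last by rewrite addn_gt0 n_gt0.
have := congr1 (fun A => complexify A *m powers n x) QE.
rewrite /complexify map_mxB map_mxN !map_mxM mulmxBl mulNmx -!mulmxA.
rewrite [_ *m powers n x in X in _ - X]companion_powers// -scalemxAr => ->.
(* [first_row] picks the entry x^0 = 1 of [powers n x]. *)
congr (- _); rewrite -[RHS]mulmx1; congr (_ *m _).
apply/matrixP => i j; rewrite !ord1 !mxE eqxx (bigD1 (Ordinal n_gt0)) //= !mxE.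
rewrite eqxx mulr1 big1 ?addr0 ?rmorph1 // => l l0.
by rewrite !mxE (negbTE (l0 : l != 0%N :> nat)) rmorph0 mul0r.
Qed.

End Companion.

(** * Hankel matrices of sums of geometric sequences *)

Section Hankel.
Variable R : realType.
Variables (n : nat) (x c : 'I_n -> R[i]) (eta : 'cV[R]_(n + n)).
Hypothesis etaE : complexify eta = \sum_j c j *: powers (n + n) (x j).

Let etaiE i : (eta i 0)%:C%C = \sum_j c j * x j ^+ i.
Proof.
move/matrixP/(_ i 0): etaE; rewrite summxE mxE => ->.
by apply: eq_bigr => j _; rewrite !mxE.
Qed.

(** Entrywise, x_l^(i+j) = x_l^i x_l^j. *)
Lemma hankel_vandermonde :
  let P := Vandermonde n (\row_j x j) in
  complexify (hankel eta) = P *m diag_mx (\row_j c j) *m P^T.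
Proof.
apply/matrixP => i j; rewrite !mxE etaiE; apply: eq_bigr => l _.
by rewrite mul_mx_diag !mxE /= exprD; ring.
Qed.

Lemma hankel_unitmx :
  injective x -> (forall j, c j != 0) -> hankel eta \in unitmx.
Proof.
move=> x_inj c_neq0; rewrite -(map_unitmx (real_complex R)).
rewrite -/(complexify _) hankel_vandermonde !unitmx_mul unitmx_tr andbAC andbb.
rewrite !unitmxE !unitfE det_Vandermonde det_diag; apply/andP; split.
  apply/prodf_neq0 => i _; apply/prodf_neq0 => j ij; rewrite !mxE subr_eq0.
  by apply: contraTneq ij => /x_inj ->; rewrite ltnn.
by apply/prodf_neq0 => i _; rewrite mxE.
Qed.

(** Row i is the sum over l of c_l x_l^i times the polynomial evaluated at its root x_l. *)
Lemma hankel_recurrence (a : 'cV[R]_n) :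
  (forall j, x j ^+ n + \sum_(l < n) (a l 0)%:C%C * x j ^+ l = 0) ->
  hankel eta *m a + dsubmx eta = 0.
Proof.
move=> ax0; apply/matrixP => i j; rewrite ord1 !mxE; apply: complexI.
rewrite rmorphD rmorph_sum rmorph0 /= etaiE.
under eq_bigr do rewrite rmorphM /= mxE etaiE mulr_suml.
rewrite exchange_big -big_split big1 //= => l _.
transitivity
    (c l * x l ^+ i * (x l ^+ n + \sum_(k < n) (a k 0)%:C%C * x l ^+ k)).
  rewrite addrC mulrDr exprD; congr (_ + _); first by ring.
  by rewrite mulr_sumr; apply: eq_bigr => k _; rewrite exprD; ring.
by rewrite ax0 mulr0.
Qed.

End Hankel.

(* Assumption 5 is imposed on a subset V0 of V containing the initial         *)
(* condition v(0), V0 = V being allowed: the other hypotheses force           *)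
(* C_j(0, w, sigma) = 0, while V contains the origin.                         *)
Theorem lemma2 (R : realType) (nz nv nw ns r n d : nat) (hr : (1 < r)%N)
  (* plant and exosystem *)
  (V V0 : set 'cV[R]_nv) (W : set 'cV[R]_nw) (Sset : set 'cV[R]_ns)
  (S : 'cV[R]_ns -> 'M[R]_nv)
  (f : 'cV[R]_nz * R * 'cV[R]_nv * 'cV[R]_nw -> 'cV[R]_nz)
  (g : 'cV[R]_nz * R * 'cV[R]_nv * 'cV[R]_nw -> 'cV[R]_r)
  (h : 'cV[R]_nv * 'cV[R]_nw -> R) (b : R) (k : nat)
  (V_compact : compact V) (W_compact : compact W) (Sset_compact : compact Sset)
  (V_0 : V 0) (W_0 : W 0) (V0_V : V0 `<=` V)
  (b_gt0 : 0 < b)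
  (k_gt0 : (0 < k)%N) (f_Ck : Ck k f) (g_Ck : Ck k g) (h_Ck : Ck k h)
  (h_0 : forall w, W w -> h (0, w) = 0)
  (f_0 : forall w, W w -> f (0, 0, 0, w) = 0)
  (g_0 : forall w, W w -> g (0, 0, 0, w) = 0)
  (A1 : assumption1 Sset S)
  (* steady state of the plant *)
  (x : 'cV[R]_nv * 'cV[R]_nw * 'cV[R]_ns -> 'cV[R]_r)
  (z : 'cV[R]_nv * 'cV[R]_nw * 'cV[R]_ns -> 'cV[R]_nz)
  (u : 'cV[R]_nv * 'cV[R]_nw * 'cV[R]_ns -> R)
  (A2 : assumption2 hr W Sset S f g h b x z u)
  (A3 : assumption3 V W Sset S f h z)
  (A4 : assumption4 W Sset u)
  (* filter and its steady state *)
  (lambda : 'cV[R]_r) (A_hurwitz : hurwitz (filter_mx lambda))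
  (alpha : 'I_d -> 'I_nv -> nat)
  (Phiu : 'cV[R]_ns -> 'M[R]_d)
  (Gammau : 'cV[R]_nw -> 'cV[R]_ns -> 'rV[R]_d)
  (u_gen : input_generator W Sset S u alpha Phiu Gammau)
  (Pu : 'cV[R]_nw -> 'cV[R]_ns -> 'M[R]_(r, d))
  (Pu_sylvester : forall w sigma, W w -> Sset sigma ->
     Pu w sigma *m Phiu sigma =
       filter_mx lambda *m Pu w sigma + last_col R r *m Gammau w sigma)
  (omega : 'cV[R]_ns -> 'I_n -> R)
  (C : 'I_n -> 'cV[R]_nv * 'cV[R]_nw * 'cV[R]_ns -> R[i])
  (xhat2_expansion :
     harmonic_expansion V W Sset S (xhat2 hr alpha Pu) omega C)
  (A5 : assumption5 V0 W Sset C)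
  (* steady-state generator and internal model *)
  (a : 'cV[R]_ns -> 'cV[R]_n) (a_coefs : generator_coefs Sset omega a)
  (m : 'cV[R]_(n + n)) (M_hurwitz : hurwitz (companion m))
  (v : R -> 'cV[R]_nv) (w : 'cV[R]_nw) (sigma : 'cV[R]_ns)
  (v_traj : exo_traj S sigma v)
  (v0_V0 : V0 (v 0)) (w_W : W w) (sigma_S : Sset sigma)
  (Q : 'M[R]_(n + n, n))
  (Q_sylvester : companion m *m Q - Q *m companion (a sigma) =
     - (last_col R (n + n) *m first_row R n)) :
  let xi t := derivatives_col n (fun s => xhat2 hr alpha Pu (v s, w, sigma)) t in
  let theta t := Q *m xi t in
  forall t : R, 0 <= t ->
    hankel (theta t) \in unitmx /\
    exists ac : 'cV[R]_n,
      unique (fun c => hankel (theta t) *m c + dsubmx (theta t) = 0) ac /\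
      ac = a sigma.
Proof.
move=> xi theta t _.
have [omega_inj qE] := xhat2_expansion.
have {}qE := qE v w sigma v_traj (V0_V _ v0_V0) w_W sigma_S.
pose x_ j := imag R (omega sigma j).
have x_inj : injective x_ by move=> i j /imag_inj /(omega_inj _ sigma_S).
pose c_ j := C j (v 0, w, sigma) * expi (omega sigma j * t).
have c_neq0 j : c_ j != 0 by rewrite mulf_neq0 ?A5 ?expi_neq0.
have xi_powers : complexify (xi t) = \sum_j c_ j *: powers n (x_ j).
  apply/matrixP => i j; rewrite ord1 summxE !mxE.
  rewrite (derive1n_exp_sum _ _ _ _ _ qE).
  by apply: eq_bigr => l _; rewrite !mxE.
have a_root j : x_ j ^+ n + \sum_(l < n) (a sigma l 0)%:C%C * x_ j ^+ l = 0.
  (* Evaluated at mu_j, the product has a zero factor of index j. *)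
  have /(congr1 (horner^~ (x_ j))) := a_coefs _ sigma_S.
  rewrite hornerD hornerXn horner_sum horner_prod.
  rewrite [RHS](bigD1 j) //= hornerXsubC subrr mul0r => pE.
  by rewrite -[RHS]pE; congr (_ + _); apply: eq_bigr => l _;
    rewrite hornerZ hornerXn.
have /fin_all_exists2[s s_neq0 QE] : forall j : 'I_n, exists2 s, s != 0 &
    complexify Q *m powers n (x_ j) = s *: powers (n + n) (x_ j).
  move=> j.
  (* The index j itself witnesses 0 < n. *)
  exact: sylvester_powers Q_sylvester (a_root j) (leq_ltn_trans _ (ltn_ord j)).
have thetaE : complexify (theta t) =
    \sum_j (c_ j * s j) *: powers (n + n) (x_ j).
  rewrite /complexify map_mxM -/(complexify _) -/(complexify (xi t)) xi_powers.
  rewrite mulmx_sumr; apply: eq_bigr => j _.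
  by rewrite -scalemxAr QE scalerA.
have Theta_unit : hankel (theta t) \in unitmx.
  by apply: hankel_unitmx thetaE x_inj _ => j; rewrite mulf_neq0.
have a_sol := hankel_recurrence _ _ _ _ _ thetaE _ a_root.
split=> //; exists (a sigma); split=> //; split=> // a' a'_sol.
(* Two solutions have the same image under the invertible Hankel matrix. *)
apply: (can_inj (mulKmx Theta_unit)).
by apply: (addIr (dsubmx (theta t))); rewrite a_sol a'_sol.
Qed.
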